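(* Let $\varepsilon\ge0$, let $\mu_0\in\mathcal P(\mathcal X_0)$, $\mu_1\in\mathcal P(\mathcal X_1)$, and let $\hat\mu_{0,n},\hat\mu_{1,n}$ be the empirical measures of independent collections of $n$ i.i.d. samples from $\mu_0$ and $\mu_1$, respectively. Then $$\mathbb E\big[\,|\mathsf{EGW}_p^{\varepsilon}(\hat\mu_{0,n},\hat\mu_{1,n})-\mathsf{EGW}_p^{\varepsilon}(\mu_0,\mu_1)|\,\big]\le C_{\mathrm B_0,\mathrm B_1}\big(\sqrt{N_0-1}+\sqrt{N_1-1}\big)n^{-1/2},$$ where $C_{\mathrm B_0,\mathrm B_1}=\frac32\sup_{\|x_0\|_1=1,\ \|x_1\|_1=1}\|\mathrm B_1^{\intercal}\mathrm B_1x_1-\mathrm B_0^{\intercal}\mathrm B_0x_0\|_\infty$ (the supremum being over $x_0,x_1\in\mathbb R^k$).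
   Context: $\mathcal X_0=\{x_0^{(1)},\dots,x_0^{(N_0)}\}$, $\mathcal X_1=\{x_1^{(1)},\dots,x_1^{(N_1)}\}$ are finite sets, $\mathcal P(\mathcal X_i)$ is the set of probability measures on $\mathcal X_i$, $k=N_0N_1$, $p>0$, and $\kappa_i:\mathcal X_i\times\mathcal X_i\to\mathbb R$ ($i=0,1$) are arbitrary functions. For $\varepsilon\ge0$, $$\mathsf{EGW}_p^\varepsilon(\mu_0,\mu_1)=\inf_{\pi\in\Pi(\mu_0,\mu_1)}\int|\kappa_0(x,x')-\kappa_1(y,y')|^p\,d\pi\otimes\pi(x,y,x',y')+\varepsilon\,\mathsf{KL}(\pi\|\mu_0\otimes\mu_1),$$ where $\Pi(\mu_0,\mu_1)$ is the set of couplings and $\mathsf{KL}$ is the Kullback–Leibler divergence; for $\varepsilon=0$ this is the $p$-th power of the $p$-Gromov–Wasserstein cost. A measure $\pi$ on $\mathcal X_0\times\mathcal X_1$ is identified with the vector $x\in\mathbb R^k$ with entry $\pi(\{(x_0^{(i)},x_1^{(j)})\})$ at index $(i-1)N_1+j$; $\mathrm M\in\mathbb R^{k\times k}$ is the symmetric matrix for which $\frac12x^{\intercal}\mathrm Mx=\int|\kappa_0(x,x')-\kappa_1(y,y')|^pd\pi\otimes\pi$ for all $\pi$, and $\mathrm B_0\in\mathbb R^{r_0\times k},\mathrm B_1\in\mathbb R^{r_1\times k}$ ($r_0,r_1\le k$) are such that $\mathrm M=\mathrm B_1^{\intercal}\mathrm B_1-\mathrm B_0^{\intercal}\mathrm B_0$.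 *)

(* Defs.v *)
From HB Require Import structures.
From mathcomp Require Import all_boot all_order all_algebra.
From mathcomp Require Import all_classical all_reals all_analysis.

Set Implicit Arguments.
Unset Strict Implicit.
Unset Printing Implicit Defensive.

Import Order.TTheory GRing.Theory Num.Theory.
Import numFieldNormedType.Exports.

Local Open Scope classical_set_scope.
Local Open Scope ring_scope.

(* The i-th point of a finite set with N points is encoded as the i-th element
   of 'I_N, and a measure on a finite set is encoded by its mass function. *)

Definition is_prob (R : realType) (T : finType) (mu : T -> R) : Prop :=
  (forall a, 0 <= mu a) /\ \sum_a mu a = 1.

(* A measure on 'I_N0 x 'I_N1 is a nonnegative N0 x N1 matrix. *)
Definition coupling (R : realType) (N0 N1 : nat)
    (mu0 : 'I_N0 -> R) (mu1 : 'I_N1 -> R) : set 'M[R]_(N0, N1) :=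
  [set pi | [/\ forall i j, 0 <= pi i j,
                forall i, \sum_j pi i j = mu0 i &
                forall j, \sum_i pi i j = mu1 j]].

Definition gw_cost (R : realType) (N0 N1 : nat)
    (kappa0 : 'I_N0 -> 'I_N0 -> R) (kappa1 : 'I_N1 -> 'I_N1 -> R) (p : R)
    (pi : 'M[R]_(N0, N1)) : R :=
  \sum_i \sum_j \sum_i' \sum_j'
    `|kappa0 i i' - kappa1 j j'| `^ p * (pi i j * pi i' j').

(* Kullback-Leibler divergence; it is +oo unless f is absolutely continuous
   with respect to g.  Points with f a = 0 contribute 0, as they should. *)
Definition KL (R : realType) (T : finType) (f g : T -> R) : \bar R :=
  if [forall a, (g a == 0) ==> (f a == 0)]
  then (\sum_a f a * ln (f a / g a))%:E else +oo%E.

Definition EGW (R : realType) (N0 N1 : nat)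
    (kappa0 : 'I_N0 -> 'I_N0 -> R) (kappa1 : 'I_N1 -> 'I_N1 -> R)
    (p eps : R) (mu0 : 'I_N0 -> R) (mu1 : 'I_N1 -> R) : \bar R :=
  ereal_inf
    [set ((gw_cost kappa0 kappa1 p pi)%:E
          + eps%:E * KL (fun ij : 'I_N0 * 'I_N1 => pi ij.1 ij.2)
                        (fun ij => mu0 ij.1 * mu1 ij.2)%R)%E
    | pi in coupling mu0 mu1].

Definition vec_of (R : realType) (N0 N1 : nat) (pi : 'M[R]_(N0, N1)) :
  'cV[R]_(N0 * N1) := (mxvec pi)^T.

Lemma nth_pairs (S T : Type) (x0 : S) (y0 : T) (s : seq S) (t : seq T) a b :
  (a < size s)%N -> (b < size t)%N ->
  nth (x0, y0) [seq (x, y) | x <- s, y <- t] (a * size t + b)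
  = (nth x0 s a, nth y0 t b).
Proof.
move=> + hb; elim: s a => [|x s IH] [|a] //= ha; rewrite nth_cat size_map.
  by rewrite mul0n add0n hb (nth_map y0).
by rewrite mulSn -addnA ltnNge leq_addr /= addKn IH.
Qed.

(* Counting from 0, the entry pi i j sits at index i * N1 + j of vec_of pi. *)
Lemma vec_ofE (R : realType) (N0 N1 : nat) (pi : 'M[R]_(N0, N1))
    (i : 'I_N0) (j : 'I_N1) (l : 'I_(N0 * N1)) :
  l = (i * N1 + j)%N :> nat -> vec_of pi l 0 = pi i j.
Proof.
move=> hl; suff -> : l = mxvec_index i j by rewrite mxE mxvecE.
apply: (can_inj (cast_ordK (esym (mxvec_cast N0 N1)))).
rewrite cast_ordK; apply: enum_val_inj.
rewrite enum_rankK (enum_val_nth (i, j)) /= hl.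
have -> : enum {: 'I_N0 * 'I_N1}
          = [seq (x, y) | x <- enum 'I_N0, y <- enum 'I_N1].
  by rewrite enumT unlock.
have := @nth_pairs _ _ i j (enum 'I_N0) (enum 'I_N1) i j.
by rewrite !size_enum_ord !nth_ord_enum => ->.
Qed.

Definition is_quadratic_matrix (R : realType) (N0 N1 : nat)
    (kappa0 : 'I_N0 -> 'I_N0 -> R) (kappa1 : 'I_N1 -> 'I_N1 -> R) (p : R)
    (M : 'M[R]_(N0 * N1)) : Prop :=
  M^T = M /\
  forall pi : 'M[R]_(N0, N1), (forall i j, 0 <= pi i j) ->
    2^-1 * ((vec_of pi)^T *m M *m vec_of pi) 0 0
    = gw_cost kappa0 kappa1 p pi.

Definition norm1 (R : realType) (k : nat) (x : 'cV[R]_k) : R :=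
  \sum_i `|x i 0|.

(* On matrices `|_| is the largest absolute value of an entry. *)
Definition C_B (R : realType) (k r0 r1 : nat)
    (B0 : 'M[R]_(r0, k)) (B1 : 'M[R]_(r1, k)) : R :=
  3 / 2 * sup [set y : R | exists x0 x1 : 'cV[R]_k,
    [/\ norm1 x0 = 1, norm1 x1 = 1 &
        y = `|B1^T *m B1 *m x1 - B0^T *m B0 *m x0| ]].

Definition empirical (R : realType) (T : finType) (n : nat) (x : 'I_n -> T) :
  T -> R := fun a => #|[pred i | x i == a]|%:R / n%:R.

(* The sigma-algebra generated by a random element of a finite set. *)
Definition sigma_of (Omega : Type) (T : finType) (Z : Omega -> T) :
  set (set Omega) := [set Z @^-1` A | A in [set: set T]].

Definition identically_distributed (d : measure_display)
    (Omega : measurableType d) (R : realType) (P : probability Omega R)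
    (T : finType) (mu : T -> R) (n : nat) (Z : 'I_n -> Omega -> T) : Prop :=
  (forall i, sigma_of (Z i) `<=` measurable) /\
  (forall i a, P (Z i @^-1` [set a]) = (mu a)%:E).

Definition mutually_independent (d : measure_display)
    (Omega : measurableType d) (R : realType) (P : probability Omega R)
    (I : finType) (F : I -> set (set Omega)) : Prop :=
  forall (J : {set I}) (E : I -> set Omega),
    (forall i, i \in J -> F i (E i)) ->
    P (\bigcap_(i in [set` J]) E i) = (\prod_(i in J) P (E i))%E.

(* Two independent collections of n i.i.d. samples, from mu0 and mu1: all the
   2n variables together are mutually independent. *)
Definition independent_iid_samples (d : measure_display)
    (Omega : measurableType d) (R : realType) (P : probability Omega R)
    (T0 T1 : finType) (mu0 : T0 -> R) (mu1 : T1 -> R) (n : nat)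
    (Z0 : 'I_n -> Omega -> T0) (Z1 : 'I_n -> Omega -> T1) : Prop :=
  [/\ identically_distributed P mu0 Z0,
      identically_distributed P mu1 Z1 &
      mutually_independent P
        (fun s : 'I_n + 'I_n =>
           match s with inl i => sigma_of (Z0 i) | inr i => sigma_of (Z1 i) end)].

(* Main.v *)
(* The regularized objective is Lipschitz in the marginals by a purely primal
   argument. Given a coupling pi of (mu0, mu1), move its first marginal to mu0'
   with the Markov kernel of a maximal coupling of mu0 and mu0', and likewise for
   the second one. The new coupling pi' is at l1-distance at most
   |mu0' - mu0|_1 + |mu1' - mu1|_1 from pi, its entropy relative to the product
   of its marginals has not increased (data processing), and by symmetry of M
     F(pi') - F(pi) = 1/2 (pi' - pi)^T M (pi' + pi) <= |pi' - pi|_1 |M x|_oo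
   with x = (pi + pi') / 2 of l1-norm 1.  It remains to bound
   E |mu^_n - mu|_1 by sqrt((N - 1) / n), which follows from the variances
   mu_a (1 - mu_a) / n by the AM-GM inequality. *)
Require Import Defs.
From HB Require Import structures.
From mathcomp Require Import all_boot all_order all_algebra.
From mathcomp Require Import all_classical all_reals all_analysis.
From mathcomp Require Import ring lra.
Set Implicit Arguments.
Unset Strict Implicit.
Unset Printing Implicit Defensive.

Import Order.TTheory GRing.Theory Num.Theory.
Import numFieldNormedType.Exports.
Local Open Scope classical_set_scope.
Local Open Scope ring_scope.

(** * Transport of one mass function to another *)

(** The kernel stays at [x] with probability [min (mu x) (mu' x) / mu x] and otherwise redraws from
    the normalized excess of [mu'] over [mu]. The mass redrawn is [D], half the l1-distance, and
    moving a unit of mass changes a row by at most 2 in l1-norm. *)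
Lemma transport_kernel {R : realType} {T : finType} (mu mu' : T -> R) :
  is_prob mu -> is_prob mu' ->
  exists K : T -> T -> R,
    [/\ forall x y, 0 <= K x y, forall x, \sum_y K x y = 1,
        forall y, \sum_x mu x * K x y = mu' y &
        \sum_x mu x * (\sum_y `|K x y - (x == y)%:R|) <= \sum_x `|mu' x - mu x| ].
Proof.
move=> [mu_ge0 mu1] [mu'_ge0 mu'1].
pose m x := Num.min (mu x) (mu' x).
pose D := \sum_x (mu' x - m x).
have m_ge0 x : 0 <= m x by rewrite le_min mu_ge0 mu'_ge0.
have m_le x : m x <= mu x by rewrite ge_min lexx.
have m_le' x : m x <= mu' x by rewrite ge_min lexx orbT.
have D_ge0 : 0 <= D by apply: sumr_ge0 => x _; rewrite subr_ge0.
have DE : \sum_x (mu x - m x) = D by rewrite /D !sumrB mu1 mu'1.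
have D2 : D + D = \sum_x `|mu' x - mu x|.
  rewrite -{1}DE -big_split /=; apply: eq_bigr => x _; rewrite /m.
  case: (leP (mu x) (mu' x)) => h; first by rewrite ger0_norm ?subr_ge0//; ring.
  by rewrite ltr0_norm ?subr_lt0//; ring.
(* When [D] is 0 there is no excess to normalize and no mass to move; any probability would do, and
   [mu'] is one. *)
pose nu x := if D == 0 then mu' x else (mu' x - m x) / D.
have nu_ge0 x : 0 <= nu x.
  by rewrite /nu; case: eqP => // _; rewrite divr_ge0// subr_ge0.
have nu1 : \sum_x nu x = 1.
  rewrite /nu; case: (eqVneq D 0) => [//|D0].
  by rewrite -mulr_suml divff.
have Dnu x : D * nu x = mu' x - m x.
  rewrite /nu; case: (eqVneq D 0) => [D0|D0]; last by rewrite mulrC divfK.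
  rewrite D0 mul0r; apply/esym/eqP.
  have /eqP := D0; rewrite /D psumr_eq0 => [/allP/(_ x)|y _]; last by rewrite subr_ge0.
  by rewrite mem_index_enum => /(_ isT).
(* Where [mu x] is 0 the quotient is 0 by convention, so row [x] of the kernel is [nu], with weight
   0. *)
pose a x := m x / mu x.
have mua x : mu x * a x = m x.
  rewrite /a; case: (eqVneq (mu x) 0) => [mux0|mux0]; last by rewrite mulrC divfK.
  by rewrite mux0 mul0r; apply/eqP; rewrite eq_le m_ge0 -mux0 m_le.
have a_ge0 x : 0 <= a x by rewrite divr_ge0.
have a_le1 x : a x <= 1.
  rewrite /a; case: (eqVneq (mu x) 0) => [->|mux0]; first by rewrite invr0 mulr0.
  by rewrite ler_pdivrMr ?mul1r// lt_neqAle eq_sym mux0 mu_ge0.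
have sum_delta (F : T -> R) y : \sum_x F x * (x == y)%:R = F y.
  rewrite (bigD1 y)//= eqxx mulr1 big1 ?addr0// => x /negbTE ->.
  by rewrite mulr0.
have sum_delta' x : \sum_y (x == y)%:R = 1 :> R.
  rewrite (bigD1 x)//= eqxx big1 ?addr0// => y; rewrite eq_sym => /negbTE ->.
  by [].
exists (fun x y => a x * (x == y)%:R + (1 - a x) * nu y); split.
- by move=> x y; rewrite addr_ge0// mulr_ge0// ?subr_ge0.
- by move=> x; rewrite big_split /= -!mulr_sumr sum_delta' nu1; ring.
- move=> y; under eq_bigr => x _.
    have -> : mu x * (a x * (x == y)%:R + (1 - a x) * nu y)
      = mu x * a x * (x == y)%:R + (mu x - mu x * a x) * nu y by ring.
    rewrite mua; over.
  by rewrite big_split /= sum_delta -mulr_suml DE Dnu; ring.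
rewrite -D2.
have -> : D + D = \sum_x (mu x - m x) * 2 by rewrite -mulr_suml DE; ring.
apply: ler_sum => x _.
(* The moved mass [mu x - m x] is [mu x * (1 - a x)], and row [x] minus the point mass at [x] is
   [1 - a x] times the difference of two probabilities. *)
rewrite -(mua x) -{2}(mulr1 (mu x)) -mulrBr -mulrA; apply: ler_wpM2l => //.
have -> : (1 - a x) * 2 = \sum_y (1 - a x) * (nu y + (x == y)%:R).
  by rewrite -mulr_sumr big_split /= nu1 sum_delta'; ring.
apply: ler_sum => y _.
have -> : a x * (x == y)%:R + (1 - a x) * nu y - (x == y)%:R
   = (1 - a x) * (nu y - (x == y)%:R) by ring.
rewrite normrM ger0_norm ?subr_ge0//; apply: ler_wpM2l; first by rewrite subr_ge0.
by rewrite (le_trans (ler_normB _ _))// !ger0_norm.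
Qed.

(** * Relative entropy on finite sets *)

(** This is [ln t <= t - 1] at the quotient [t] of the two ratios, multiplied by [f]. It yields both
    Gibbs' inequality and data processing after summation. *)
Lemma entropy_term_le {R : realType} (f g f' g' : R) :
  0 < f -> 0 < g -> 0 < f' -> 0 < g' ->
  f * ln (f' / g') - f * ln (f / g) <= g * (f' / g') - f.
Proof.
move=> f0 g0 f'0 g'0.
have r0 : 0 < f / g by rewrite divr_gt0.
have r'0 : 0 < f' / g' by rewrite divr_gt0.
rewrite -mulrBr -ln_div//.
have h : ln ((f' / g') / (f / g)) <= (f' / g') / (f / g) - 1.
  rewrite -{1}[X in ln X](subrK 1) addrC le_ln1Dx//.
  by rewrite ltrBrDr addNr divr_gt0.
apply: (le_trans (ler_wpM2l (ltW f0) h)).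
have -> : f * (f' / g' / (f / g) - 1) = g * (f' / g') - f; last by [].
by field; rewrite !gt_eqF.
Qed.

(* Agrees with [KL] only when f vanishes wherever g does (see [KLE]). *)
Definition rel_entropy {R : realType} {T : finType} (f g : T -> R) : R :=
  \sum_a f a * ln (f a / g a).

Lemma KLE {R : realType} {T : finType} (f g : T -> R) :
  (forall a, g a = 0 -> f a = 0) -> KL f g = (rel_entropy f g)%:E.
Proof.
move=> fg; rewrite /KL ifT//; apply/forallP => a.
by apply/implyP => /eqP /fg ->.
Qed.

(** Gibbs' inequality: the case [f' = g' = 1] of [entropy_term_le] bounds each term below by
    [f a - g a], and these differences sum to 0. *)
Lemma rel_entropy_ge0 {R : realType} {T : finType} (f g : T -> R) :
  is_prob f -> is_prob g -> (forall a, g a = 0 -> f a = 0) ->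
  0 <= rel_entropy f g.
Proof.
move=> [f0 f1] [g0 g1] fg.
have -> : 0 = \sum_a (f a - g a) :> R by rewrite sumrB f1 g1 subrr.
apply: ler_sum => a _.
case: (eqVneq (f a) 0) => [->|fa]; first by rewrite mul0r sub0r oppr_le0.
have fa0 : 0 < f a by rewrite lt_neqAle eq_sym fa f0.
have ga0 : 0 < g a.
  by rewrite lt_neqAle g0 andbT eq_sym; apply: contra_neq fa => /fg.
have := @entropy_term_le R (f a) (g a) 1 1 fa0 ga0 ltr01 ltr01.
rewrite divr1 ln1 mulr0 mulr1; lra.
Qed.

(** For each [b], the ratio [f' b / g' b] is compared with every [f a / g a] by [entropy_term_le],
    with weight [K a b]. Summed over [a], the right-hand sides telescope to a nonpositive number. *)
Lemma rel_entropy_data_processing {R : realType} {T U : finType} (f g : T -> R) (K : T -> U -> R) :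
  (forall a, 0 <= f a) -> (forall a, 0 <= g a) -> (forall a, g a = 0 -> f a = 0) ->
  (forall a b, 0 <= K a b) -> (forall a, \sum_b K a b = 1) ->
  rel_entropy (fun b => \sum_a f a * K a b) (fun b => \sum_a g a * K a b)
  <= rel_entropy f g.
Proof.
move=> f0 g0 fg K0 K1; rewrite /rel_entropy.
set f' := fun b => \sum_a f a * K a b.
set g' := fun b => \sum_a g a * K a b.
have sumK (h : T -> R) : \sum_b \sum_a h a * K a b = \sum_a h a.
  by rewrite exchange_big /=; apply: eq_bigr => a _; rewrite -mulr_sumr K1 mulr1.
have f'0 b : 0 <= f' b by apply: sumr_ge0 => a _; rewrite mulr_ge0.
have g'0 b : 0 <= g' b by apply: sumr_ge0 => a _; rewrite mulr_ge0.
have pos (h : T -> R) a b : (forall a, 0 <= h a) -> 0 < h a -> 0 < K a b ->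
    0 < \sum_a h a * K a b.
  move=> h0 ha Kab; rewrite (bigD1 a)//= ltr_wpDr ?mulr_gt0//.
  by apply: sumr_ge0 => c _; rewrite mulr_ge0.
(* The rows of [K] sum to 1, so each term can be spread over all [b]. *)
have -> : \sum_a f a * ln (f a / g a) = \sum_b \sum_a (f a * ln (f a / g a)) * K a b.
  by rewrite sumK.
rewrite -subr_le0 -sumrB.
have key b : f' b * ln (f' b / g' b) - \sum_a (f a * ln (f a / g a)) * K a b
    <= g' b * (f' b / g' b) - f' b.
  set r := f' b / g' b.
  have r0 : 0 <= r by rewrite divr_ge0.
  rewrite /f' /g' !mulr_suml -!sumrB; apply: ler_sum => a _.
  have -> : f a * K a b * ln r - f a * ln (f a / g a) * K a b
    = K a b * (f a * ln r - f a * ln (f a / g a)) by ring.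
  have -> : g a * K a b * r - f a * K a b
    = K a b * (g a * r - f a) by ring.
  case: (eqVneq (K a b) 0) => [->|Kn]; first by rewrite !mul0r.
  apply: ler_wpM2l => //.
  case: (eqVneq (f a) 0) => [->|fn].
    by rewrite !mul0r !subr0 mulr_ge0.
  have Kp : 0 < K a b by rewrite lt_neqAle eq_sym Kn K0.
  have fp : 0 < f a by rewrite lt_neqAle eq_sym fn f0.
  have gp : 0 < g a.
    by rewrite lt_neqAle g0 andbT eq_sym; apply: contra_neq fn => /fg.
  by apply: entropy_term_le => //; apply: (pos _ a).
apply: (le_trans (ler_sum _ (fun b _ => key b))).
apply: sumr_le0 => b _.
(* The remainder [g' b * (f' b / g' b) - f' b] is 0 unless [g' b] vanishes, in which case it is
   [- f' b]. *)
case: (eqVneq (g' b) 0) => [->|gn]; first by rewrite mul0r sub0r oppr_le0.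
by rewrite mulrC divfK// subrr.
Qed.

(** * Norm estimates and the Lipschitz bound for the quadratic cost *)

Lemma norm_entry_le {R : realType} {m n : nat} (A : 'M[R]_(m, n)) i j :
  `|A i j| <= `|A|.
Proof.
rewrite {2}/Num.norm/= mx_normrE.
exact: (@le_bigmax _ _ _ _ (fun ij : 'I_m * 'I_n => `|A ij.1 ij.2|) (i, j)).
Qed.

Lemma mulmx_norm_le {R : realType} {m k : nat} (A : 'M[R]_(m, k)) (x : 'cV[R]_k) :
  `|A *m x| <= `|A| * norm1 x.
Proof.
have x0 : 0 <= norm1 x by apply: sumr_ge0.
rewrite {1}/Num.norm/= mx_normrE; apply: bigmax_le => [|[i j] _ /=].
  by rewrite mulr_ge0.
rewrite (ord1 j) mxE (le_trans (ler_norm_sum _ _ _))// /norm1 mulr_sumr.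
by apply: ler_sum => l _; rewrite normrM ler_wpM2r// norm_entry_le.
Qed.

Lemma dot_le {R : realType} {k : nat} (u v : 'cV[R]_k) :
  `|(u^T *m v) 0 0| <= norm1 u * `|v|.
Proof.
rewrite mxE (le_trans (ler_norm_sum _ _ _))// /norm1 mulr_suml.
by apply: ler_sum => l _; rewrite mxE normrM ler_wpM2l// norm_entry_le.
Qed.

Lemma norm1Z {R : realType} {k : nat} a (x : 'cV[R]_k) :
  norm1 (a *: x) = `|a| * norm1 x.
Proof.
by rewrite /norm1 mulr_sumr; apply: eq_bigr => i _; rewrite mxE normrM.
Qed.

Lemma norm1D {R : realType} {k : nat} (x y : 'cV[R]_k) :
  norm1 (x + y) <= norm1 x + norm1 y.
Proof.
rewrite /norm1 -big_split /=; apply: ler_sum => i _.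
by rewrite mxE ler_normD.
Qed.

Lemma norm1_eq0 {R : realType} {k : nat} (x : 'cV[R]_k) : norm1 x = 0 -> x = 0.
Proof.
move=> /eqP; rewrite psumr_eq0// => /allP h; apply/matrixP => i j.
rewrite (ord1 j) mxE; apply/eqP; rewrite -normr_eq0.
by apply: (h i); rewrite mem_index_enum.
Qed.

Lemma norm1_vec_of {R : realType} {N0 N1 : nat} (pi : 'M[R]_(N0, N1)) :
  norm1 (vec_of pi) = \sum_i \sum_j `|pi i j|.
Proof.
rewrite /norm1 pair_bigA /= (reindex _ (curry_mxvec_bij N0 N1)) /=.
by apply: eq_bigr => -[i j] _; rewrite /vec_of mxE mxvecE.
Qed.

Lemma C_B_ge0 {R : realType} {k r0 r1 : nat} (B0 : 'M[R]_(r0, k)) (B1 : 'M[R]_(r1, k)) :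
  0 <= C_B B0 B1.
Proof.
apply: mulr_ge0 => //; set S := [set y | _].
(* A set without supremum, such as the empty set that arises for [k = 0], has [sup] equal to 0 by
   convention. *)
have [[[y Sy] ubS]|noS] := pselect (has_sup S); last by rewrite sup_out.
by apply: le_trans (ub_le_sup ubS Sy); case: Sy => x0 [x1 [_ _ ->]].
Qed.

(* Only the diagonal x0 = x1 of the supremum in [C_B] is used; its factor 3/2 is not sharp here. *)
Lemma quadratic_norm_le {R : realType} {k r0 r1 : nat}
    (B0 : 'M[R]_(r0, k)) (B1 : 'M[R]_(r1, k)) (x : 'cV[R]_k) :
  `|(B1^T *m B1 - B0^T *m B0) *m x| <= C_B B0 B1 * norm1 x.
Proof.
case: (eqVneq (norm1 x) 0) => [x0|x0].
  by rewrite (norm1_eq0 x0) mulmx0 normr0 mulr_ge0 ?C_B_ge0// sumr_ge0.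
have xp : 0 < norm1 x by rewrite lt_neqAle eq_sym x0 sumr_ge0.
pose y := (norm1 x)^-1 *: x.
have y1 : norm1 y = 1 by rewrite norm1Z gtr0_norm ?invr_gt0// mulVf.
have -> : x = norm1 x *: y by rewrite scalerA divff// scale1r.
rewrite norm1Z y1 mulr1 -scalemxAr normrZ gtr0_norm// mulrC ler_wpM2r ?(ltW xp)//.
rewrite /C_B; set S := [set y | _].
(* Boundedness guarantees that [sup S] is the true supremum and not the default value 0. *)
have Sub : has_ubound S.
  exists (`|B1^T *m B1| + `|B0^T *m B0|) => _ [x0' [x1' [n0 n1 ->]]].
  rewrite (le_trans (ler_normB _ _))// lerD//.
    by rewrite (le_trans (mulmx_norm_le _ _))// n1 mulr1.
  by rewrite (le_trans (mulmx_norm_le _ _))// n0 mulr1.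
have h : `|(B1^T *m B1 - B0^T *m B0) *m y| <= sup S.
  by apply: ub_le_sup => //; exists y, y; split => //; rewrite mulmxBl.
have := normr_ge0 ((B1^T *m B1 - B0^T *m B0) *m y); lra.
Qed.

(** A difference of squares for the symmetric form, followed by l1-sup duality. The factor 1/2
    cancels the bound 2 on the l1-norm of a sum of two probability vectors. *)
Lemma gw_cost_lipschitz {R : realType} {N0 N1 : nat}
    (kappa0 : 'I_N0 -> 'I_N0 -> R) (kappa1 : 'I_N1 -> 'I_N1 -> R) (p : R)
    (M : 'M[R]_(N0 * N1)) (r0 r1 : nat)
    (B0 : 'M[R]_(r0, N0 * N1)) (B1 : 'M[R]_(r1, N0 * N1))
    (pi pi' : 'M[R]_(N0, N1)) :
  is_quadratic_matrix kappa0 kappa1 p M -> M = B1^T *m B1 - B0^T *m B0 ->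
  (forall i j, 0 <= pi i j) -> \sum_i \sum_j pi i j = 1 ->
  (forall i j, 0 <= pi' i j) -> \sum_i \sum_j pi' i j = 1 ->
  gw_cost kappa0 kappa1 p pi' <= gw_cost kappa0 kappa1 p pi
     + C_B B0 B1 * \sum_i \sum_j `|pi' i j - pi i j|.
Proof.
move=> [Msym MF] MB pi0 pi1 pi'0 pi'1.
rewrite -!MF// -lerBlDl.
set u := vec_of pi'; set v := vec_of pi.
have sym : (v^T *m M *m u) 0 0 = (u^T *m M *m v) 0 0.
  have -> : u^T *m M *m v = (v^T *m M *m u)^T; last by rewrite [RHS]mxE.
    by rewrite !trmx_mul Msym [v^T^T]trmxK mulmxA.
have -> : 2^-1 * (u^T *m M *m u) 0 0 - 2^-1 * (v^T *m M *m v) 0 0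
    = 2^-1 * ((u - v)^T *m (M *m (u + v))) 0 0.
  have -> : (u - v)^T *m (M *m (u + v))
      = u^T *m M *m u + u^T *m M *m v - v^T *m M *m u - v^T *m M *m v.
    by rewrite [(u - v)^T]linearB /= mulmxBl !mulmxDr !mulmxA opprD addrA.
  (* Generalizing the four products to arbitrary 1 x 1 matrices leaves an identity between
     scalars. *)
  move: sym; move: (v^T *m M *m u) (u^T *m M *m v) (u^T *m M *m u) (v^T *m M *m v).
  by move=> a b a' b' ab; rewrite !mxE ab; ring.
have n1 (q : 'M[R]_(N0, N1)) : (forall i j, 0 <= q i j) -> \sum_i \sum_j q i j = 1 ->
    norm1 (vec_of q) = 1.
  move=> q0 <-; rewrite norm1_vec_of; apply: eq_bigr => i _.
  by apply: eq_bigr => j _; rewrite ger0_norm.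
have uv2 : norm1 (u + v) <= 2.
  by rewrite (le_trans (norm1D _ _))// !n1// lexx.
have -> : \sum_i \sum_j `|pi' i j - pi i j| = norm1 (u - v).
  have -> : u - v = vec_of (pi' - pi) by rewrite /u /v /vec_of !linearB.
  rewrite norm1_vec_of; apply: eq_bigr => i _; apply: eq_bigr => j _.
  by rewrite !mxE.
have h1 := le_trans (ler_norm _) (dot_le (u - v) (M *m (u + v))).
have h2 : norm1 (u - v) * `|M *m (u + v)| <= norm1 (u - v) * (C_B B0 B1 * 2).
  apply: ler_wpM2l; first exact: sumr_ge0.
  rewrite MB (le_trans (quadratic_norm_le _ _ _))//.
  by apply: ler_wpM2l => //; exact: C_B_ge0.
lra.
Qed.

(** * Couplings and the transport of their marginals *)

(** A real-valued form of the penalty, faithful on couplings because these are absolutely continuous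
    with respect to the product of their marginals. *)
Definition coupling_entropy {R : realType} {N0 N1 : nat}
    (mu0 : 'I_N0 -> R) (mu1 : 'I_N1 -> R) (pi : 'M[R]_(N0, N1)) : R :=
  rel_entropy (fun ij : 'I_N0 * 'I_N1 => pi ij.1 ij.2)
    (fun ij => mu0 ij.1 * mu1 ij.2).

(** A point without marginal mass has a row or column of nonnegative entries with sum 0. *)
Lemma coupling_abs_cont {R : realType} {N0 N1 : nat}
    (mu0 : 'I_N0 -> R) (mu1 : 'I_N1 -> R) (pi : 'M[R]_(N0, N1)) :
  coupling mu0 mu1 pi -> forall i j, mu0 i * mu1 j = 0 -> pi i j = 0.
Proof.
move=> [pi0 pi_row pi_col] i j /eqP; rewrite mulf_eq0 => /orP[] /eqP h.
- have /eqP := pi_row i; rewrite h psumr_eq0// => /allP/(_ j).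
  by rewrite mem_index_enum => /(_ isT)/eqP.
- have /eqP := pi_col j; rewrite h psumr_eq0// => /allP/(_ i).
  by rewrite mem_index_enum => /(_ isT)/eqP.
Qed.

Lemma coupling_total {R : realType} {N0 N1 : nat}
    (mu0 : 'I_N0 -> R) (mu1 : 'I_N1 -> R) (pi : 'M[R]_(N0, N1)) :
  is_prob mu0 -> coupling mu0 mu1 pi -> \sum_i \sum_j pi i j = 1.
Proof. by move=> [_ <-] [_ row _]; apply: eq_bigr => i _. Qed.

Lemma is_prob_prod {R : realType} {S T : finType} (f : S -> R) (g : T -> R) :
  is_prob f -> is_prob g -> is_prob (fun st : S * T => f st.1 * g st.2).
Proof.
move=> [f0 f1] [g0 g1]; split=> [[s t]|]; first exact: mulr_ge0.
rewrite -(pair_bigA _ (fun s t => f s * g t)) /=.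
by under eq_bigr do rewrite -mulr_sumr g1 mulr1.
Qed.

Lemma coupling_entropy_ge0 {R : realType} {N0 N1 : nat}
    (mu0 : 'I_N0 -> R) (mu1 : 'I_N1 -> R) (pi : 'M[R]_(N0, N1)) :
  is_prob mu0 -> is_prob mu1 -> coupling mu0 mu1 pi ->
  0 <= coupling_entropy mu0 mu1 pi.
Proof.
move=> mu0P mu1P cpi; apply: rel_entropy_ge0.
- split=> [[i j]|]; first by case: cpi.
  by rewrite -(pair_bigA _ (fun i j => pi i j)) /= (coupling_total mu0P cpi).
- exact: is_prob_prod.
- by move=> [i j]; exact: coupling_abs_cont.
Qed.

Lemma coupling_tr {R : realType} {N0 N1 : nat}
    (mu0 : 'I_N0 -> R) (mu1 : 'I_N1 -> R) (pi : 'M[R]_(N0, N1)) :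
  coupling mu0 mu1 pi -> coupling mu1 mu0 pi^T.
Proof.
by move=> [pi0 row col]; split=> [i j|i|i]; [rewrite mxE|rewrite -col|rewrite -row];
  rewrite ?(eq_bigr _ (fun _ _ => mxE _ _ _ _)) //; apply: eq_bigr => j _; rewrite mxE.
Qed.

Lemma coupling_entropy_tr {R : realType} {N0 N1 : nat}
    (mu0 : 'I_N0 -> R) (mu1 : 'I_N1 -> R) (pi : 'M[R]_(N0, N1)) :
  coupling_entropy mu1 mu0 pi^T = coupling_entropy mu0 mu1 pi.
Proof.
rewrite /coupling_entropy /rel_entropy.
rewrite -(pair_bigA _ (fun i j => pi^T i j * ln (pi^T i j / (mu1 i * mu0 j)))) exchange_big /=.
rewrite pair_bigA /=; apply: eq_bigr => -[i j] _ /=.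
by rewrite mxE [mu1 j * _]mulrC.
Qed.

(** The first coordinate is resampled through the kernel of [transport_kernel], the second is kept.
    The same kernel sends the product of the old marginals to that of the new ones, so data
    processing controls the entropy. *)
Lemma coupling_transport_left {R : realType} {N0 N1 : nat}
    (mu0 mu0' : 'I_N0 -> R) (mu1 : 'I_N1 -> R) (pi : 'M[R]_(N0, N1)) :
  is_prob mu0 -> is_prob mu0' -> is_prob mu1 -> coupling mu0 mu1 pi ->
  exists pi' : 'M[R]_(N0, N1),
    [/\ coupling mu0' mu1 pi',
        \sum_i \sum_j `|pi' i j - pi i j| <= \sum_i `|mu0' i - mu0 i| &
        coupling_entropy mu0' mu1 pi' <= coupling_entropy mu0 mu1 pi].
Proof.
move=> mu0P mu0'P mu1P cpi; have [pi0 row col] := cpi.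
have [K [K0 K1 muK Kd]] := transport_kernel mu0P mu0'P.
pose pi' : 'M[R]_(N0, N1) := \matrix_(i', j) \sum_i pi i j * K i i'.
exists pi'; split.
- split=> [i j|i|j].
  + by rewrite mxE sumr_ge0// => l _; rewrite mulr_ge0.
  + rewrite -muK; under eq_bigr do rewrite mxE.
    by rewrite exchange_big /=; apply: eq_bigr => l _; rewrite -mulr_suml row.
  + rewrite -col; under eq_bigr do rewrite mxE.
    by rewrite exchange_big /=; apply: eq_bigr => l _; rewrite -mulr_sumr K1 mulr1.
- apply: le_trans Kd.
  (* The change is [pi] integrated against the kernel minus the identity. *)
  have E i j : pi' i j - pi i j = \sum_l pi l j * (K l i - (l == i)%:R).
    rewrite mxE; under [RHS]eq_bigr do rewrite mulrBr.
    rewrite sumrB; congr (_ - _); rewrite (bigD1 i)//= eqxx mulr1 big1 ?addr0//.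
    by move=> l /negbTE ->; rewrite mulr0.
  have le1 : \sum_i \sum_j `|pi' i j - pi i j|
      <= \sum_i \sum_j \sum_l pi l j * `|K l i - (l == i)%:R|.
    apply: ler_sum => i _; apply: ler_sum => j _.
    rewrite E (le_trans (ler_norm_sum _ _ _))//; apply: ler_sum => l _.
    by rewrite normrM ger0_norm.
  apply: (le_trans le1).
  (* With the source index [l] outermost, summing [pi l j] over [j] produces the weight [mu0 l] of
     [Kd]. *)
  under eq_bigr do rewrite exchange_big /=.
  rewrite exchange_big /=; apply: ler_sum => l _.
  rewrite -row mulr_sumr; apply: ler_sum => i _.
  by rewrite mulr_suml.
(* [KK] is [K] on the first coordinate tensored with the identity on the second. *)
- pose KK (a b : 'I_N0 * 'I_N1) : R := K a.1 b.1 * (a.2 == b.2)%:R.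
  have sumKK (h : 'I_N0 -> 'I_N1 -> R) b :
      \sum_a h a.1 a.2 * KK a b = \sum_i h i b.2 * K i b.1.
    rewrite -(pair_bigA _ (fun i j => h i j * KK (i, j) b)) /=; apply: eq_bigr => i _.
    rewrite (bigD1 b.2)//= /KK /= eqxx mulr1 big1 ?addr0// => j /negbTE ->.
    by rewrite !mulr0.
  have := @rel_entropy_data_processing R _ _ (fun ij => pi ij.1 ij.2)
     (fun ij => mu0 ij.1 * mu1 ij.2) KK.
  rewrite /coupling_entropy.
  have -> : (fun b => \sum_a pi a.1 a.2 * KK a b) = (fun ij => pi' ij.1 ij.2).
    by apply/funext => b; rewrite sumKK mxE.
  have -> : (fun b => \sum_a mu0 a.1 * mu1 a.2 * KK a b) = (fun ij => mu0' ij.1 * mu1 ij.2).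
    apply/funext => b; rewrite (sumKK (fun i j => mu0 i * mu1 j)) -muK mulr_suml.
    by apply: eq_bigr => i _; ring.
  apply.
  + by move=> [i j].
  + by move=> [i j] /=; rewrite mulr_ge0//; [case: mu0P | case: mu1P].
  + by move=> [i j]; exact: coupling_abs_cont.
  + by move=> a b; rewrite mulr_ge0.
  + move=> [i j]; rewrite -(pair_bigA _ (fun i' j' => KK (i, j) (i', j'))) /=.
    rewrite -(K1 i); apply: eq_bigr => i' _.
    rewrite (bigD1 j)//= /KK /= eqxx mulr1 big1 ?addr0// => j'.
    by rewrite eq_sym => /negbTE ->; rewrite mulr0.
Qed.

(** One marginal at a time: the second move is a left transport of the transposed coupling, and
    starts from a coupling whose first marginal is already [mu0']. The l1-costs add by the triangle
    inequality. *)
Lemma coupling_transport {R : realType} {N0 N1 : nat}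
    (mu0 mu0' : 'I_N0 -> R) (mu1 mu1' : 'I_N1 -> R) (pi : 'M[R]_(N0, N1)) :
  is_prob mu0 -> is_prob mu0' -> is_prob mu1 -> is_prob mu1' ->
  coupling mu0 mu1 pi ->
  exists pi' : 'M[R]_(N0, N1),
    [/\ coupling mu0' mu1' pi',
        \sum_i \sum_j `|pi' i j - pi i j|
          <= \sum_i `|mu0' i - mu0 i| + \sum_j `|mu1' j - mu1 j| &
        coupling_entropy mu0' mu1' pi' <= coupling_entropy mu0 mu1 pi].
Proof.
move=> mu0P mu0'P mu1P mu1'P cpi.
have [q [cq dq eq]] := coupling_transport_left mu0P mu0'P mu1P cpi.
have [s [cs ds es]] := coupling_transport_left mu1P mu1'P mu0'P (coupling_tr cq).
exists s^T; split.
- exact: coupling_tr.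
- apply: le_trans (lerD dq ds).
  rewrite [X in _ <= _ + X]exchange_big -big_split; apply: ler_sum => i _ /=.
  rewrite -big_split; apply: ler_sum => j _ /=; rewrite !mxE addrC.
  by rewrite (le_trans _ (ler_normD _ _))// addrA subrK.
- by rewrite coupling_entropy_tr (le_trans es)// coupling_entropy_tr.
Qed.

(** * Lipschitz dependence of [EGW] on the marginals *)

Section EGWLipschitz.
Context {R : realType} {N0 N1 : nat}.
Variables (kappa0 : 'I_N0 -> 'I_N0 -> R) (kappa1 : 'I_N1 -> 'I_N1 -> R) (p eps : R).
Hypothesis eps_ge0 : 0 <= eps.

Lemma EGWE (mu0 : 'I_N0 -> R) (mu1 : 'I_N1 -> R) :
  EGW kappa0 kappa1 p eps mu0 mu1 =
  ereal_inf [set (gw_cost kappa0 kappa1 p pi + eps * coupling_entropy mu0 mu1 pi)%:E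
            | pi in coupling mu0 mu1].
Proof.
rewrite /EGW; congr (ereal_inf _); apply: eq_imagel => pi cpi.
rewrite KLE; last by move=> [i j]; exact: coupling_abs_cont.
by rewrite -EFinM -EFinD.
Qed.

Lemma EGW_fin_num (mu0 : 'I_N0 -> R) (mu1 : 'I_N1 -> R) :
  is_prob mu0 -> is_prob mu1 -> EGW kappa0 kappa1 p eps mu0 mu1 \is a fin_num.
Proof.
move=> mu0P mu1P; rewrite EGWE; apply/fin_real/andP; split.
- apply: (@lt_le_trans _ _ 0%E); first exact: ltNyr.
  apply: le_ereal_inf_tmp => _ [pi cpi <-].
  rewrite lee_fin addr_ge0//; last first.
    by rewrite mulr_ge0// coupling_entropy_ge0.
  have [pi0 _ _] := cpi.
  do 4 (apply: sumr_ge0 => ? _); by rewrite mulr_ge0 ?powR_ge0// mulr_ge0.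
- have [mu0_ge0 mu0_1] := mu0P; have [mu1_ge0 mu1_1] := mu1P.
  (* The product coupling shows that the infimum is below a finite value. *)
  pose pi : 'M[R]_(N0, N1) := \matrix_(i, j) (mu0 i * mu1 j).
  apply: le_lt_trans (ltry (gw_cost kappa0 kappa1 p pi
    + eps * coupling_entropy mu0 mu1 pi)).
  apply: ereal_inf_lbound; exists pi => //; split=> [i j|i|j].
  + by rewrite mxE mulr_ge0.
  + by under eq_bigr do rewrite mxE; rewrite -mulr_sumr mu1_1 mulr1.
  + by under eq_bigr do rewrite mxE; rewrite -mulr_suml mu0_1 mul1r.
Qed.

Variables (M : 'M[R]_(N0 * N1)) (r0 r1 : nat)
  (B0 : 'M[R]_(r0, N0 * N1)) (B1 : 'M[R]_(r1, N0 * N1)).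
Hypothesis hM : is_quadratic_matrix kappa0 kappa1 p M.
Hypothesis hB : M = B1^T *m B1 - B0^T *m B0.

(** Every coupling of the old marginals is transported to a competitor for the new ones; the infimum
    is then taken over the old couplings. *)
Let EGW_le (mu0 mu0' : 'I_N0 -> R) (mu1 mu1' : 'I_N1 -> R) :
  is_prob mu0 -> is_prob mu0' -> is_prob mu1 -> is_prob mu1' ->
  (EGW kappa0 kappa1 p eps mu0' mu1' <= EGW kappa0 kappa1 p eps mu0 mu1 +
    (C_B B0 B1 * (\sum_i `|mu0' i - mu0 i| + \sum_j `|mu1' j - mu1 j|))%:E)%E.
Proof.
move=> mu0P mu0'P mu1P mu1'P.
rewrite -leeBlDr// [leRHS]EGWE; apply: le_ereal_inf_tmp => _ [pi cpi <-].
have [pi' [cpi' d e]] := coupling_transport mu0P mu0'P mu1P mu1'P cpi.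
rewrite leeBlDr// EGWE; apply: ge_ereal_inf; eexists; first by exists pi'; first exact: cpi'.
have [pi0 _ _] := cpi; have [pi'0 _ _] := cpi'.
have := gw_cost_lipschitz hM hB pi0 (coupling_total mu0P cpi) pi'0 (coupling_total mu0'P cpi').
have := ler_wpM2l (C_B_ge0 B0 B1) d.
have := ler_wpM2l eps_ge0 e.
rewrite -EFinD lee_fin; lra.
Qed.

(** The one-sided bound is used in both directions; finiteness of the two values turns the
    extended-real difference into a real one. *)
Lemma EGW_lipschitz (mu0 mu0' : 'I_N0 -> R) (mu1 mu1' : 'I_N1 -> R) :
  is_prob mu0 -> is_prob mu0' -> is_prob mu1 -> is_prob mu1' ->
  (`|EGW kappa0 kappa1 p eps mu0' mu1' - EGW kappa0 kappa1 p eps mu0 mu1| <=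
    (C_B B0 B1 * (\sum_i `|mu0' i - mu0 i| + \sum_j `|mu1' j - mu1 j|))%:E)%E.
Proof.
move=> mu0P mu0'P mu1P mu1'P.
have := EGW_le mu0P mu0'P mu1P mu1'P.
have := EGW_le mu0'P mu0P mu1'P mu1P.
under [in X in (_ <= _ + X)%E -> _]eq_bigr do rewrite distrC.
under [X in _ * (_ + X)]eq_bigr do rewrite distrC.
have /fineK <- := EGW_fin_num mu0P mu1P.
have /fineK <- := EGW_fin_num mu0'P mu1'P.
rewrite -!EFinD !lee_fin ler_norml => h1 h2.
by apply/andP; split; lra.
Qed.

End EGWLipschitz.

(** * Integrals, independence and expectations *)

(** The integral of a nonnegative function is a supremum over the simple functions below it, hence
    monotone for arbitrary functions. The deviation of the empirical [EGW] can thus be integrated as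
    it stands. *)
Lemma ge0_le_integralT {d : measure_display} {Omega : measurableType d} {R : realType}
    (P : {measure set Omega -> \bar R}) (f g : Omega -> \bar R) :
  (forall w, (0 <= f w)%E) -> (forall w, (f w <= g w)%E) ->
  (\int[P]_w f w <= \int[P]_w g w)%E.
Proof.
move=> f0 fg; rewrite !ge0_integralTE//; last first.
  by move=> w; exact: le_trans (fg w).
by apply: le_ereal_sup => _ [h hf <-]; exists h => // w; exact: le_trans (fg w).
Qed.

Lemma mutually_independent_pair {d : measure_display} {Omega : measurableType d}
    {R : realType} {P : probability Omega R} {I : finType}
    {F : I -> set (set Omega)} {i j : I} {A B : set Omega} :
  mutually_independent P F -> i != j -> F i A -> F j B ->
  P (A `&` B) = (P A * P B)%E.
Proof.
move=> indep ij FA FB.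
have ji : (j == i) = false by rewrite eq_sym (negbTE ij).
have /= := indep [set i; j]%SET (fun k => if k == i then A else B).
rewrite big_setU1 ?inE//= big_set1 eqxx ji => <-.
- congr (P _); apply/seteqP; split=> [w [Aw Bw] k /=|w h].
    by rewrite !inE => /orP[] /eqP ->; rewrite ?eqxx ?ji.
  split; first by have := h i; rewrite /= eqxx; apply; rewrite !inE eqxx.
  by have := h j; rewrite /= ji; apply; rewrite !inE eqxx orbT.
- by move=> k; rewrite !inE => /orP[] /eqP ->; rewrite ?eqxx ?ji.
Qed.

(** Integrability travels with the value of the integral, so that linearity can be applied
    repeatedly. *)
Definition has_mean {d : measure_display} {Omega : measurableType d} {R : realType}
    (P : probability Omega R) (f : Omega -> R) (m : R) : Prop :=
  P.-integrable setT (EFin \o f) /\ (\int[P]_w (f w)%:E = m%:E)%E.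

Section HasMean.
Context {d : measure_display} {Omega : measurableType d} {R : realType}.
Context {P : probability Omega R}.

Lemma has_mean_cst (c : R) : has_mean P (fun=> c) c.
Proof.
split; first exact: finite_measure_integrable_cst.
by rewrite (integral_cst P measurableT c%:E) [X in (_ * X)%E]probability_setT mule1.
Qed.

Lemma has_mean_indic (A : set Omega) (m : R) :
  measurable A -> P A = m%:E -> has_mean P \1_A m.
Proof.
by move=> mA PA; split; [exact: integrable_indic|rewrite integral_indic// setIT].
Qed.

Lemma has_meanD (f g : Omega -> R) (a b : R) :
  has_mean P f a -> has_mean P g b -> has_mean P (fun w => f w + g w) (a + b).
Proof.
move=> [fi fE] [gi gE]; split; first exact: (integrableD measurableT fi gi).
under eq_integral do rewrite EFinD.
by rewrite (integralD measurableT fi gi) /= fE gE.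
Qed.

Lemma has_meanZ (c : R) (f : Omega -> R) (a : R) :
  has_mean P f a -> has_mean P (fun w => c * f w) (c * a).
Proof.
move=> [fi fE]; split; first exact: (integrableZl measurableT c fi).
under eq_integral do rewrite EFinM.
by rewrite (integralZl measurableT fi) /= fE.
Qed.

Lemma has_mean_sum {I : finType} (f : I -> Omega -> R) (a : I -> R) :
  (forall i, has_mean P (f i) (a i)) ->
  has_mean P (fun w => \sum_i f i w) (\sum_i a i).
Proof.
move=> h; rewrite unlock; elim: (index_enum I) => [|i s IH] /=.
  exact: has_mean_cst.
exact: has_meanD.
Qed.

End HasMean.

(** * The l1-deviation of an empirical measure *)

(** The gap between the two sides is the sum of squared deviations of [mu] from the uniform mass. *)
Lemma sum_sqr_ge {R : realType} {T : finType} (mu : T -> R) :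
  is_prob mu -> #|T|%:R^-1 <= \sum_a mu a ^+ 2.
Proof.
move=> [_ mu1].
have T0 : #|T|%:R != 0 :> R.
  rewrite pnatr_eq0; apply/eqP => T0; move/eqP: mu1; rewrite big_pred0 1?eq_sym ?oner_eq0// => a.
  by have := card0_eq T0 a.
rewrite -subr_ge0.
have -> : \sum_a mu a ^+ 2 - #|T|%:R^-1 = \sum_a (mu a - #|T|%:R^-1) ^+ 2.
  under [RHS]eq_bigr => a _.
    have -> : (mu a - #|T|%:R^-1) ^+ 2
      = mu a ^+ 2 + (- 2 * #|T|%:R^-1) * mu a + #|T|%:R^-1 ^+ 2 by ring.
    over.
  rewrite !big_split /= -mulr_sumr mu1 sumr_const -mulr_natl; field.
  by rewrite T0.
by apply: sumr_ge0 => a _; rewrite sqr_ge0.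
Qed.

Section EmpiricalDeviation.
Context {d : measure_display} {Omega : measurableType d} {R : realType}.
Variables (P : probability Omega R) (T : finType) (mu : T -> R) (n : nat).
Variable (Z : 'I_n -> Omega -> T).
Hypothesis n_gt0 : (0 < n)%N.
Hypothesis muP : is_prob mu.
Hypothesis Zid : identically_distributed P mu Z.
Hypothesis Zindep : forall i j a, i != j ->
  P (Z i @^-1` [set a] `&` Z j @^-1` [set a]) = (mu a * mu a)%:E.

Let n0 : n%:R != 0 :> R. Proof. by rewrite pnatr_eq0 -lt0n. Qed.

Lemma is_prob_empirical (x : 'I_n -> T) : is_prob (empirical R x).
Proof.
split=> [a|]; first by rewrite divr_ge0.
rewrite /empirical -mulr_suml -natr_sum.
have -> : (\sum_a #|[pred i | x i == a]|)%N = n.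
  under eq_bigr do rewrite -sum1_card.
  by rewrite -[RHS]card_ord -sum1_card (partition_big x predT)//=.
by rewrite divff.
Qed.

Let measurable_fiber i a : measurable (Z i @^-1` [set a]).
Proof. by apply: Zid.1; exists [set a]. Qed.

Let A a i : set Omega := Z i @^-1` [set a].

Let empiricalE a w :
  empirical R (fun i => Z i w) a = n%:R^-1 * \sum_i \1_(A a i) w.
Proof.
rewrite /empirical mulrC; congr (_ * _).
rewrite -sum1_card natr_sum [RHS]big_mkcond [LHS]big_mkcond /=.
apply: eq_bigr => i _; rewrite inE indicE /A.
by case: (eqVneq (Z i w) a) => h; [rewrite mem_set|rewrite memNset//; exact/eqP].
Qed.

(** The variance of an empirical frequency. The square is expanded into indicators of fibers and of
    their pairwise intersections, whose probabilities are known. *)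
Lemma has_mean_sqr_deviation a :
  has_mean P (fun w => (empirical R (fun i => Z i w) a - mu a) ^+ 2)
    ((mu a - mu a ^+ 2) / n%:R).
Proof.
pose f w : R := n%:R^-1 ^+ 2 * \sum_i \sum_j \1_(A a i `&` A a j) w
  + ((- 2 * mu a / n%:R) * (\sum_i \1_(A a i) w) + mu a ^+ 2).
have -> : (fun w => (empirical R (fun i => Z i w) a - mu a) ^+ 2) = f.
  apply/funext => w; rewrite empiricalE /f.
  have -> : \sum_i \sum_j \1_(A a i `&` A a j) w
     = (\sum_i \1_(A a i) w) * (\sum_i \1_(A a i) w) :> R.
    rewrite mulr_suml; apply: eq_bigr => i _; rewrite mulr_sumr.
    by apply: eq_bigr => j _; rewrite indicI.
  by field.
(* [m i j] is the probability that samples [i] and [j] both equal [a]; each row has one diagonal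
   entry and [n - 1] others. *)
pose m (i j : 'I_n) := if i == j then mu a else mu a ^+ 2.
have -> : (mu a - mu a ^+ 2) / n%:R = n%:R^-1 ^+ 2 * (\sum_(i < n) \sum_(j < n) m i j)
  + ((- 2 * mu a / n%:R) * (\sum_(i < n) mu a) + mu a ^+ 2).
  have -> : \sum_(i < n) \sum_(j < n) m i j
      = \sum_(i < n) (n%:R * mu a ^+ 2 + (mu a - mu a ^+ 2)).
    apply: eq_bigr => i _; rewrite (bigD1 i)//= {1}/m eqxx.
    under eq_bigr => j ji do rewrite /m eq_sym (negbTE ji).
    rewrite sumr_const cardC1 card_ord -mulr_natl.
    by rewrite -(prednK n_gt0) -natr1; ring.
  by rewrite !sumr_const !card_ord -(mulr_natl (mu a)) -(mulr_natl (_ + _)); field.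
apply: has_meanD; [apply: has_meanZ|apply: has_meanD; [apply: has_meanZ|exact: has_mean_cst]].
- apply: has_mean_sum => i; apply: has_mean_sum => j; apply: has_mean_indic.
    by apply: measurableI; exact: measurable_fiber.
  rewrite /m; case: eqVneq => [<-|ij]; first by rewrite setIid Zid.2.
  by rewrite Zindep// expr2.
- by apply: has_mean_sum => i; apply: has_mean_indic; [exact: measurable_fiber|exact: Zid.2].
Qed.

(** The absolute values are dominated by quadratic expressions in the frequencies, whose means
    follow from the variances by linearity. *)
Lemma empirical_deviation_majorant :
  exists G m, [/\ has_mean P G m,
    forall w, \sum_a `|empirical R (fun i => Z i w) a - mu a| <= G w &
    m <= Num.sqrt (#|T|%:R - 1) * n%:R `^ (- 2^-1)].
Proof.
have N_gt0 : (0 < #|T|)%N.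
  rewrite lt0n; apply/eqP => T0; have [_ /eqP] := muP; rewrite big_pred0 1?eq_sym ?oner_eq0// => a.
  by have := card0_eq T0 a.
have n_pos : 0 < n%:R :> R by rewrite ltr0n.
rewrite powRN powR12_sqrt//.
(* On a single point the scale [s] below would be 0; there both measures are the same point mass. *)
have [N1|N1] := leqP #|T| 1.
  have {}N1 : #|T| = 1%N by apply/eqP; rewrite eqn_leq N1.
  exists (fun=> 0), 0; split.
  - exact: has_mean_cst.
  - move=> w; rewrite big1// => a _.
    have T1 (f : T -> R) : is_prob f -> f a = 1.
      move=> [_ <-]; rewrite (bigD1 a)//= big1 ?addr0// => b.
      have /fintype_le1P/(_ a b) -> := eq_leq N1.
      by rewrite eqxx.
    by rewrite !T1// ?subrr ?normr0//; exact: is_prob_empirical.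
  - by rewrite mulr_ge0// invr_ge0.
pose N : R := #|T|%:R.
have N_pos : 0 < N by rewrite ltr0n.
have Nm1 : 0 < N - 1 by rewrite subr_gt0 ltr1n.
pose x := Num.sqrt (N - 1) / Num.sqrt n%:R.
have x_gt0 : 0 < x by rewrite divr_gt0// sqrtr_gt0.
have x2 : x ^+ 2 = (N - 1) / n%:R by rewrite expr_div_n !sqr_sqrtr// ltW.
(* [s] is the standard deviation of an empirical frequency under the uniform law, which balances the
   two AM-GM terms. *)
pose s := x / N.
have s_gt0 : 0 < s by exact: divr_gt0.
have s2_gt0 : 0 < 2 * s by apply: mulr_gt0.
exists (fun w => \sum_a ((2 * s)^-1 * (empirical R (fun i => Z i w) a - mu a) ^+ 2 + s / 2)),
  (\sum_a ((2 * s)^-1 * ((mu a - mu a ^+ 2) / n%:R) + s / 2)); split.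
- apply: has_mean_sum => a; apply: has_meanD; last exact: has_mean_cst.
  exact/has_meanZ/has_mean_sqr_deviation.
- (* AM-GM: 2 s |t| <= t^2 + s^2 *)
  move=> w; apply: ler_sum => a _; set t := _ - _.
  rewrite -(ler_pM2l s2_gt0) mulrDr mulVKf ?(gt_eqF s2_gt0)// -(real_normK (num_real t)).
  have := sqr_ge0 (`|t| - s).
  have -> : 2 * s * (s / 2) = s ^+ 2 by field.
  rewrite sqrrB; lra.
(* By [sum_sqr_ge] the variances sum to at most [(1 - N^-1) / n]; each of the two parts of the mean
   then contributes at most [x / 2]. *)
- rewrite big_split /= -mulr_sumr -mulr_suml sumrB muP.2 sumr_const -[X in _ + X]mulr_natl -/N -/x.
  have h := sum_sqr_ge muP; rewrite -/N in h.
  apply: (@le_trans _ _ ((2 * s)^-1 * ((1 - N^-1) / n%:R) + N * (s / 2))).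
    rewrite lerD2r ler_wpM2l ?invr_ge0 ?(ltW s2_gt0)//.
    by rewrite ler_wpM2r ?invr_ge0// lerB.
  have -> : (1 - N^-1) / n%:R = x ^+ 2 / N by rewrite x2; field; rewrite n0 gt_eqF.
  by rewrite le_eqVlt; apply/orP; left; apply/eqP; rewrite /s; field; rewrite !gt_eqF.
Qed.

End EmpiricalDeviation.

Theorem theorem2 (R : realType) (N0 N1 : nat)
    (kappa0 : 'I_N0 -> 'I_N0 -> R) (kappa1 : 'I_N1 -> 'I_N1 -> R)
    (p : R) (hp : 0 < p)
    (M : 'M[R]_(N0 * N1)) (hM : is_quadratic_matrix kappa0 kappa1 p M)
    (r0 r1 : nat) (hr0 : (r0 <= N0 * N1)%N) (hr1 : (r1 <= N0 * N1)%N)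
    (B0 : 'M[R]_(r0, N0 * N1)) (B1 : 'M[R]_(r1, N0 * N1))
    (hB : M = B1^T *m B1 - B0^T *m B0)
    (eps : R) (heps : 0 <= eps)
    (mu0 : 'I_N0 -> R) (mu1 : 'I_N1 -> R)
    (hmu0 : is_prob mu0) (hmu1 : is_prob mu1)
    (d : measure_display) (Omega : measurableType d) (P : probability Omega R)
    (n : nat) (hn : (0 < n)%N)
    (Z0 : 'I_n -> Omega -> 'I_N0) (Z1 : 'I_n -> Omega -> 'I_N1)
    (hZ : independent_iid_samples P mu0 mu1 Z0 Z1) :
  (\int[P]_w `| EGW kappa0 kappa1 p eps
                  (empirical R (fun i => Z0 i w)) (empirical R (fun i => Z1 i w))
                - EGW kappa0 kappa1 p eps mu0 mu1 |
   <= (C_B B0 B1 * (Num.sqrt (N0%:R - 1) + Num.sqrt (N1%:R - 1))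
       * n%:R `^ (- 2^-1))%:E)%E.
Proof.
have [Zid0 Zid1 indep] := hZ.
have Zi0 i j a : i != j ->
    P (Z0 i @^-1` [set a] `&` Z0 j @^-1` [set a]) = (mu0 a * mu0 a)%:E.
  move=> ij; rewrite (mutually_independent_pair indep (_ : inl i != inl j))//.
  - by rewrite !Zid0.2.
  - by exists [set a].
  - by exists [set a].
have Zi1 i j a : i != j ->
    P (Z1 i @^-1` [set a] `&` Z1 j @^-1` [set a]) = (mu1 a * mu1 a)%:E.
  move=> ij; rewrite (mutually_independent_pair indep (_ : inr i != inr j))//.
  - by rewrite !Zid1.2.
  - by exists [set a].
  - by exists [set a].
have [G0 [m0 [G0m G0ge m0le]]] := empirical_deviation_majorant hn hmu0 Zid0 Zi0.
have [G1 [m1 [G1m G1ge m1le]]] := empirical_deviation_majorant hn hmu1 Zid1 Zi1.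
rewrite !card_ord in m0le m1le.
have [_ GE] := has_meanZ (C_B B0 B1) (has_meanD G0m G1m).
(* The Lipschitz bound holds at every sample point, with both l1-deviations replaced by their
   majorants; the integral of the result is known exactly. *)
apply: (@le_trans _ _ (\int[P]_w (C_B B0 B1 * (G0 w + G1 w))%:E)%E).
  apply: ge0_le_integralT => w; first exact: abse_ge0.
  have := EGW_lipschitz heps hM hB hmu0 (is_prob_empirical hn (fun i => Z0 i w))
    hmu1 (is_prob_empirical hn (fun i => Z1 i w)).
  move=> /le_trans; apply; rewrite lee_fin ler_wpM2l ?C_B_ge0//.
  by rewrite lerD ?G0ge ?G1ge.
by rewrite GE lee_fin -mulrA ler_wpM2l ?C_B_ge0// mulrDl lerD.
Qed.
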